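(* There exist universal constants $C_0>0$ and $c>0$ such that the following holds. Let $n/\mu\ge\max\{4,r\}$ and $\mu\ge12\log(12n)$. For $\lambda^\star>0$, let $\Omega(\lambda^\star,\mu,r)=\{(\boldsymbol{\Lambda}^\star,\boldsymbol{U}^\star):\boldsymbol{\Lambda}^\star=\lambda^\star\boldsymbol{I}_r,\ \boldsymbol{U}^\star\in\mathbb{K}_{r,\mu}\}$ and, for each such pair, let $\mathbb{E}_{\boldsymbol{\Lambda}^\star,\boldsymbol{U}^\star}$ denote expectation when observing $\boldsymbol{Y}=\boldsymbol{U}^\star\boldsymbol{\Lambda}^\star{\boldsymbol{U}^\star}^\top+\boldsymbol{W}$ with $\boldsymbol{W}$ symmetric having independent $N(0,\sigma^2)$ entries on and above the diagonal. Then for any $0<\lambda^\star\le(6\sqrt{C_0})^{-1}\sigma\sqrt n$ and all sufficiently large $n$, $$\inf_{\widehat{\boldsymbol{U}}}\ \sup_{(\boldsymbol{\Lambda}^\star,\boldsymbol{U}^\star)\in\Omega(\lambda^\star,\mu,r)}\mathbb{E}_{\boldsymbol{\Lambda}^\star,\boldsymbol{U}^\star}\,d_{2,\infty}(\widehat{\boldsymbol{U}},\boldsymbol{U}^\star)\ \ge\ c\left(\frac{\sigma\sqrt r}{\lambda^\star}\wedge\sqrt{\frac{\mu r}{n\log(n/\mu)}}\right),$$ where the infimum is over all estimators $\widehat{\boldsymbol{U}}\in\mathbb{R}^{n\times r}$ (measurable functions of $\boldsymbol{Y}$).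
   Context: $\mathbb{K}_{r,\mu}=\{\boldsymbol{U}\in\mathbb{R}^{n\times r}:\boldsymbol{U}^\top\boldsymbol{U}=\boldsymbol{I}_r,\ \|\boldsymbol{U}\|_{2,\infty}\le\sqrt{r\mu/n}\}$, where $\|\cdot\|_{2,\infty}$ is the maximum row Euclidean norm. $d_{2,\infty}(\boldsymbol{U}_1,\boldsymbol{U}_2)=\min_{\boldsymbol{\Gamma}\in\mathbb{O}_r}\|\boldsymbol{U}_2-\boldsymbol{U}_1\boldsymbol{\Gamma}\|_{2,\infty}$. $a\wedge b=\min\{a,b\}$. *)

(* Defs.v *)
From HB Require Import structures.
From mathcomp Require Import all_boot all_order all_algebra.
From mathcomp Require Import all_classical all_reals all_analysis.
Set Implicit Arguments. Unset Strict Implicit. Unset Printing Implicit Defensive.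
Import Order.TTheory GRing.Theory Num.Theory.
Local Open Scope classical_set_scope.
Local Open Scope ring_scope.

Section defs.
Context {R : realType}.

Definition norm2inf (n m : nat) (A : 'M[R]_(n, m)) : R :=
  \big[Num.max/0]_(i < n) Num.sqrt (\sum_(j < m) A i j ^+ 2).

Definition orthogonal_mx (r : nat) (G : 'M[R]_r) : Prop := G^T *m G = 1%:M.

Definition d2inf (n r : nat) (U1 U2 : 'M[R]_(n, r)) : R :=
  inf [set norm2inf (U2 - U1 *m G) | G in [set G | orthogonal_mx G]].

Definition Kset (n r : nat) (mu : R) : set 'M[R]_(n, r) :=
  [set U | U^T *m U = 1%:M /\ norm2inf U <= Num.sqrt (r%:R * mu / n%:R)].

Definition upper_pairs (n : nat) : seq ('I_n * 'I_n) :=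
  [seq p : 'I_n * 'I_n <- [seq (i, j) | i <- enum 'I_n, j <- enum 'I_n] | (nat_of_ord p.1 <= p.2)%N].

Definition sym_of_seq (n : nat) (l : seq R) : 'M[R]_n :=
  \matrix_(i, j) nth 0 l (index (if (i <= j)%N then (i, j) else (j, i))
                                (upper_pairs n)).

(* Expectation of g(x_1, ..., x_k) where x_1, ..., x_k are iid N(0, s^2):
   iterated integral against the normal law (product measure via Tonelli). *)
Fixpoint gauss_iter (s : R) (k : nat) (g : seq R -> \bar R) : \bar R :=
  match k with
  | 0 => g [::]
  | k'.+1 => (\int[normal_prob 0 s]_x gauss_iter s k' (fun l => g (x :: l)))%E
  end.

(* an estimator (function of the observation Y) is measurable as a function of
   the independent entries of the symmetric matrix Y *)
Definition measurable_estimator (n r : nat) (Uhat : 'M[R]_n -> 'M[R]_(n, r)) : Prop :=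
  forall i j, measurable_fun [set: (size (upper_pairs n)).-tuple R]
                (fun t => Uhat (sym_of_seq n t) i j).

Definition risk (n r : nat) (sigma lam : R) (Uhat : 'M[R]_n -> 'M[R]_(n, r))
    (U : 'M[R]_(n, r)) : \bar R :=
  gauss_iter sigma (size (upper_pairs n))
    (fun l => (d2inf (Uhat (U *m (lam%:M : 'M[R]_r) *m U^T + sym_of_seq n l)) U)%:E).

End defs.
Arguments Kset {R} n r mu _.

(* Main.v *)
Require Import Defs.
From HB Require Import structures.
From mathcomp Require Import all_boot all_order all_algebra.
From mathcomp Require Import all_classical all_reals all_analysis.
From mathcomp Require Import measurable_realfun ring lra zify.
Set Implicit Arguments. Unset Strict Implicit. Unset Printing Implicit Defensive.
Import Order.TTheory GRing.Theory Num.Theory.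
Local Open Scope classical_set_scope.
Local Open Scope ring_scope.

(* Put s = n / mu and choose q of the order of max (s, lam^2 / sigma^2).  For a
   q x r sign matrix S let V = S / sqrt (120 q), let A be a fixed matrix with
   orthonormal columns and rows of norm at most sqrt (r / s), and let U_S be the
   orthonormalisation of the stacked matrix [A; V; 0].  Since [A; V]^T [A; V] =
   1 + V^T V >= 1, orthonormalising only shrinks rows, so U_S is incoherent.

   For at least half of all S the matrix V^T V has squared Frobenius norm O(r)
   (second moment), and then a pair U_S, U_S' that is close in d_{2,oo} comes from
   signs S, S' differing in at most q r / 16 places: at most (51/32)^(q r) of the
   2^(q r) sign matrices are compatible with a given estimate.  The squared
   Frobenius norm of the signal is lam^2 r <= sigma^2 q r / 64, so the chi-square
   divergence to pure noise is too small to single out the right hypothesis, and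
   the error is at least of order sqrt (r / q). *)

(** * Iterated Gaussian integrals *)

Section gauss.
Context {R : realType}.
Implicit Types (s a x : R) (l v : seq R).
Local Notation mu := (@lebesgue_measure R).

(** By uniqueness of the measure that gives half-open intervals their length: translating an
    interval keeps its length. *)
Lemma lebesgue_measure_shift a (A : set R) : measurable A ->
  mu A = pushforward mu (fun x : R => x + a) A.
Proof.
have ms : measurable_fun [set: measurableTypeR R]
    (fun x : measurableTypeR R => x + a : measurableTypeR R).
  exact: (@measurable_funD _ _ _ _ (@id R) (cst a)).
pose f : {mfun measurableTypeR R >-> measurableTypeR R} :=
  HB.pack (fun x : R => x + a) (isMeasurableFun.Build _ _ _ _ _ ms).
move=> mA; rewrite (@lebesgue_measure_unique R (pushforward mu f))// => X [[b c] /= _ <-].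
rewrite /pushforward.
rewrite (_ : _ @^-1` _ = `](b - a), (c - a)]%classic); last first.
  by apply/seteqP; split => x /=; rewrite !in_itv /= ltrBlDr lerBrDr.
rewrite !lebesgue_measure_itv /= !lte_fin ltrD2r; case: ifP => // _.
by rewrite -!EFinB; congr EFin; ring.
Qed.

Lemma ge0_integral_shift a (f : R -> \bar R) :
  measurable_fun [set: R] f -> (forall x, 0 <= f x)%E ->
  (\int[mu]_x f ((x : R) + a)%R = \int[mu]_x f x)%E.
Proof.
move=> mf f0.
have ms : measurable_fun [set: measurableTypeR R]
    (fun x : measurableTypeR R => x + a : measurableTypeR R).
  exact: (@measurable_funD _ _ _ _ (@id R) (cst a)).
pose h : {mfun measurableTypeR R >-> measurableTypeR R} :=
  HB.pack (fun x : R => x + a) (isMeasurableFun.Build _ _ _ _ _ ms).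
transitivity (\int[pushforward mu h]_x f x)%E.
  by rewrite ge0_integral_pushforward.
by apply: eq_measure_integral => A mA _; exact/esym/lebesgue_measure_shift.
Qed.

(** The Radon-Nikodym derivative and the explicit density have the same integral over every
    measurable set, so they agree almost everywhere. *)
Lemma ge0_integral_normal_prob a s (f : R -> \bar R) :
  measurable_fun [set: R] f -> (forall x, 0 <= f x)%E ->
  (\int[normal_prob a s]_x f x = \int[mu]_x (f x * (normal_pdf a s x)%:E))%E.
Proof.
move=> mf f0; have dom := normal_prob_dominates a s.
rewrite -(Radon_Nikodym_SigmaFinite.change_of_variables dom)//.
set g := Radon_Nikodym_SigmaFinite.f _ _.
have gi : mu.-integrable [set: R] g by exact: Radon_Nikodym_SigmaFinite.f_integrable.
have mg := measurable_int _ gi.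
have mp : measurable_fun [set: R] (fun x => (normal_pdf a s x)%:E).
  by apply/measurable_EFinP; exact: measurable_normal_pdf.
apply: ge0_ae_eq_integral => //.
- exact: emeasurable_funM.
- exact: emeasurable_funM.
- by move=> x _; rewrite mule_ge0//; exact: Radon_Nikodym_SigmaFinite.f_ge0.
- by move=> x _; rewrite mule_ge0// lee_fin normal_pdf_ge0.
apply: ae_eqe_mul2l.
apply: integral_ae_eq => // E _ mE.
by rewrite -Radon_Nikodym_SigmaFinite.f_integral.
Qed.

(** The likelihood ratio of N(a, s^2) against N(0, s^2) at x. *)
Definition gauss_lr1 s a x : R := expR (a * x / s ^+ 2 - a ^+ 2 / (s ^+ 2 *+ 2)).

Lemma normal_pdf_lr s a x : s != 0 ->
  normal_pdf 0 s (x - a) = gauss_lr1 s a x * normal_pdf 0 s x.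
Proof.
move=> s0; rewrite !normal_pdfE// mulrCA /normal_fun /gauss_lr1 -expRD.
by congr (_ * expR _); field.
Qed.

Lemma measurable_gauss_lr1 s a : measurable_fun [set: R] (gauss_lr1 s a).
Proof.
apply: measurableT_comp => //; apply: measurable_funB => //.
by apply: measurable_funM => //; apply: measurable_funM.
Qed.

(** Cameron-Martin formula on the line: after passing to Lebesgue measure and translating, the shift
    of the argument becomes a likelihood-ratio weight. *)
Lemma ge0_integral_normal_shift s a (f : R -> \bar R) : s != 0 ->
  measurable_fun [set: R] f -> (forall x, 0 <= f x)%E ->
  (\int[normal_prob 0 s]_x f ((x : R) + a)%R =
   \int[normal_prob 0 s]_x ((gauss_lr1 s a x)%:E * f x))%E.
Proof.
move=> s0 mf f0.
have ms : measurable_fun [set: R] (fun x : R => x + a) by exact: measurable_funD.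
have ml : measurable_fun [set: R] (fun x => (gauss_lr1 s a x)%:E).
  by apply/measurable_EFinP; exact: measurable_gauss_lr1.
rewrite ge0_integral_normal_prob//; last exact: measurableT_comp.
rewrite [RHS]ge0_integral_normal_prob//; last 2 first.
- exact: emeasurable_funM.
- by move=> x; rewrite mule_ge0// lee_fin expR_ge0.
rewrite -[RHS](ge0_integral_shift a).
- apply: eq_integral => x _; rewrite (muleC (_%:E) (f _)) -muleA -EFinM -normal_pdf_lr//.
  by congr (_ * (normal_pdf _ _ _)%:E)%E; rewrite addrK.
- apply: emeasurable_funM; first exact: emeasurable_funM.
  by apply/measurable_EFinP; exact: measurable_normal_pdf.
- by move=> x; rewrite !mule_ge0// lee_fin ?expR_ge0// normal_pdf_ge0.
Qed.

(** [gauss_iter] integrates functions of lists, while the product sigma-algebra lives on tuples of a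
    fixed length. *)
Definition tuple_measurable k (g : seq R -> \bar R) : Prop :=
  measurable_fun [set: k.-tuple R] (fun t : k.-tuple R => g t).

Lemma gauss_iter_ge0 s k g : (forall l, 0 <= g l)%E -> (0 <= gauss_iter s k g)%E.
Proof.
elim: k g => [|k IH] g g0 //=.
by apply: integral_ge0 => x _; exact: IH.
Qed.

(** The parameter space is arbitrary so that the induction can absorb the next coordinate into it;
    Tonelli then integrates that coordinate out. *)
Lemma measurable_gauss_iter_param d (T : measurableType d) s k
    (h : T -> seq R -> \bar R) : (forall z l, 0 <= h z l)%E ->
  measurable_fun [set: T * k.-tuple R] (fun p => h p.1 p.2) ->
  measurable_fun [set: T] (fun z => gauss_iter s k (h z)).
Proof.
elim: k d T h => [|k IH] d T h h0 mh /=.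
  apply: (measurableT_comp mh (g := fun z => (z, [tuple]))).
  apply/measurable_fun_pairP; split; first exact: measurable_id.
  exact: (@measurable_cst _ _ _ _ _ [tuple]).
pose F (p : T * measurableTypeR R) := gauss_iter s k (fun l => h p.1 (p.2 :: l)).
have F0 p : (0 <= F p)%E by apply: gauss_iter_ge0.
have mF : measurable_fun setT F.
  apply: (IH _ _ (fun p l => h p.1 (p.2 :: l))) => //=.
  pose c (p : T * measurableTypeR R * k.-tuple R) : T * k.+1.-tuple R :=
    (p.1.1, [the k.+1.-tuple R of p.1.2 :: p.2]).
  apply: (measurableT_comp mh (g := c)).
  apply/measurable_fun_pairP; split => /=.
    exact: (measurableT_comp measurable_fst measurable_fst).
  apply: (@measurable_cons _ _ _ R (fun p => p.1.2)) => //.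
  exact: (measurableT_comp measurable_snd measurable_fst).
exact: (measurable_fun_fubini_tonelli_F (m2 := normal_prob 0 s) F mF F0).
Qed.

Lemma tuple_measurable_cons k g x :
  tuple_measurable k.+1 g -> tuple_measurable k (fun l => g (x :: l)).
Proof.
move=> mg; apply: (measurableT_comp mg (g := fun t : k.-tuple R => [the k.+1.-tuple R of x :: t])).
exact: measurable_cons.
Qed.

Lemma measurable_gauss_iter_cons s k g : (forall l, 0 <= g l)%E ->
  tuple_measurable k.+1 g ->
  measurable_fun [set: measurableTypeR R]
    (fun x : measurableTypeR R => gauss_iter s k (fun l => g (x :: l))).
Proof.
move=> g0 mg; apply: measurable_gauss_iter_param => //.
pose c (p : measurableTypeR R * k.-tuple R) := [the k.+1.-tuple R of p.1 :: p.2].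
apply: (measurableT_comp mg (g := c)).
by apply: (@measurable_cons _ _ _ R (fun p => p.1)); [exact: measurable_fst|exact: measurable_snd].
Qed.

Lemma eq_gauss_iter s k g g' : (forall l, size l = k -> g l = g' l) ->
  gauss_iter s k g = gauss_iter s k g'.
Proof.
elim: k g g' => [|k IH] g g' gg' /=; first exact: gg'.
by apply: eq_integral => x _; apply: IH => l sl; rewrite gg' //= sl.
Qed.

Lemma gauss_iterD s k g g' : (forall l, 0 <= g l)%E -> (forall l, 0 <= g' l)%E ->
  tuple_measurable k g -> tuple_measurable k g' ->
  (gauss_iter s k (fun l => g l + g' l) = gauss_iter s k g + gauss_iter s k g')%E.
Proof.
elim: k g g' => [//|k IH] g g' g0 g0' mg mg' /=.
rewrite -ge0_integralD//.
- by apply: eq_integral => x _; rewrite IH//; exact: tuple_measurable_cons.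
- by move=> x _; exact: gauss_iter_ge0.
- exact: measurable_gauss_iter_cons.
- by move=> x _; exact: gauss_iter_ge0.
- exact: measurable_gauss_iter_cons.
Qed.

Lemma gauss_iterZ s k g a : 0 <= a -> (forall l, 0 <= g l)%E ->
  tuple_measurable k g ->
  (gauss_iter s k (fun l => a%:E * g l) = a%:E * gauss_iter s k g)%E.
Proof.
move=> a0; elim: k g => [//|k IH] g g0 mg /=.
rewrite -ge0_integralZl//.
- by apply: eq_integral => x _; rewrite IH//; exact: tuple_measurable_cons.
- exact: measurable_gauss_iter_cons.
- by move=> x _; exact: gauss_iter_ge0.
Qed.

Lemma le_gauss_iter s k g g' : (forall l, 0 <= g l)%E -> (forall l, g l <= g' l)%E ->
  tuple_measurable k g -> tuple_measurable k g' ->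
  (gauss_iter s k g <= gauss_iter s k g')%E.
Proof.
elim: k g g' => [|k IH] g g' g0 gg' mg mg' /=; first exact: gg'.
have g0' l : (0 <= g' l)%E by exact: le_trans (gg' l).
apply: ge0_le_integral => //.
- by move=> x _; exact: gauss_iter_ge0.
- exact: measurable_gauss_iter_cons.
- exact: measurable_gauss_iter_cons.
- by move=> x _; apply: IH => //; exact: tuple_measurable_cons.
Qed.

Lemma gauss_iter_cst s k a : gauss_iter s k (fun=> a%:E) = a%:E.
Proof.
elim: k => [//|k IH] /=; under eq_integral do rewrite IH.
by rewrite integral_cst//= probability_setT mule1.
Qed.

Lemma gauss_iter_sum s k (I : Type) (r : seq I) (g : I -> seq R -> \bar R) :
  (forall i l, 0 <= g i l)%E -> (forall i, tuple_measurable k (g i)) ->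
  (gauss_iter s k (fun l => \sum_(i <- r) g i l) =
   \sum_(i <- r) gauss_iter s k (g i))%E.
Proof.
move=> g0 mg; elim: r => [|i r IH].
  under eq_gauss_iter do rewrite big_nil.
  by rewrite big_nil gauss_iter_cst.
rewrite big_cons -IH -gauss_iterD//.
- by apply: eq_gauss_iter => l _; rewrite big_cons.
- by move=> l; exact: sume_ge0.
- by rewrite /tuple_measurable; apply: emeasurable_sum.
Qed.

Lemma measurable_nth_tuple k i :
  measurable_fun [set: k.-tuple R] (fun t : k.-tuple R => nth 0 t i : R).
Proof.
have [ik|ki] := ltnP i k.
  rewrite (_ : (fun _ => _) = (@tnth _ R ^~ (Ordinal ik))); first exact: measurable_tnth.
  by apply/funext => t; rewrite (tnth_nth 0).
rewrite (_ : (fun _ => _) = cst 0); first exact: measurable_cst.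
by apply/funext => t; rewrite nth_default// size_tuple.
Qed.

(** * Likelihood ratios of shifted product laws *)

Definition gauss_lr s v l : R := \prod_(i < size v) gauss_lr1 s v`_i l`_i.

Lemma gauss_lr_gt0 s v l : 0 < gauss_lr s v l.
Proof. by apply: prodr_gt0 => i _; exact: expR_gt0. Qed.

Lemma measurable_gauss_lr k s v :
  measurable_fun [set: k.-tuple R] (fun t : k.-tuple R => gauss_lr s v t).
Proof.
rewrite /gauss_lr; apply: measurable_prod => i _.
exact: (measurableT_comp (measurable_gauss_lr1 s _) (measurable_nth_tuple _)).
Qed.

Fixpoint seq_add v l := if l is x :: l' then (x + head 0 v) :: seq_add (behead v) l' else [::].

Lemma nth_seq_add v l i : (i < size l)%N -> (seq_add v l)`_i = l`_i + v`_i.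
Proof.
elim: l v i => [//|x l IH] v [|i] /= il; first by case: v.
by rewrite IH//; case: v => //=; rewrite !nth_nil.
Qed.

(** Cameron-Martin formula in k dimensions: the induction hypothesis treats the inner integral and
    the one-dimensional formula the first coordinate. *)
Lemma gauss_iter_shift s k v f : s != 0 -> size v = k ->
  (forall l, 0 <= f l)%E -> tuple_measurable k f ->
  (gauss_iter s k (fun l => f (seq_add v l)) =
   gauss_iter s k (fun l => (gauss_lr s v l)%:E * f l))%E.
Proof.
move=> s0; elim: k v f => [|k IH] [|a v]//= f.
  by move=> _ f0 mf; rewrite /gauss_lr big_ord0 mul1e.
move=> [sv] f0 mf.
pose F x := gauss_iter s k (fun l => (gauss_lr s v l)%:E * f (x :: l))%E.
have mlr : tuple_measurable k (fun l => (gauss_lr s v l)%:E).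
  by apply/measurable_EFinP; exact: measurable_gauss_lr.
have G0 x l : (0 <= (gauss_lr s v l)%:E * f (x :: l))%E.
  by rewrite mule_ge0// lee_fin ltW// gauss_lr_gt0.
have mG x : tuple_measurable k (fun l => (gauss_lr s v l)%:E * f (x :: l))%E.
  by apply: emeasurable_funM => //; exact: tuple_measurable_cons.
have mF : measurable_fun [set: measurableTypeR R] F.
  apply: (@measurable_gauss_iter_cons s k (fun l => (gauss_lr s v (behead l))%:E * f l)%E).
    by move=> l; rewrite mule_ge0// lee_fin ltW// gauss_lr_gt0.
  apply: emeasurable_funM => //.
  exact: (measurableT_comp mlr (measurable_behead (T := R) (n := k))).
transitivity (\int[normal_prob 0 s]_x F ((x : R) + a)%R)%E.
  by apply: eq_integral => x _; rewrite (IH v (fun l => f (_ :: l)))//; exact: tuple_measurable_cons.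
rewrite ge0_integral_normal_shift//; last by move=> x; exact: gauss_iter_ge0.
apply: eq_integral => x _; rewrite -gauss_iterZ ?expR_ge0//.
apply: eq_gauss_iter => l _; rewrite muleA -EFinM; congr (_%:E * _)%E.
by rewrite /gauss_lr /= big_ord_recl.
Qed.

Lemma gauss_iter_lr s k v : s != 0 -> size v = k ->
  gauss_iter s k (fun l => (gauss_lr s v l)%:E) = 1%E.
Proof.
move=> s0 sv; under eq_gauss_iter do rewrite -[_%:E]mule1.
rewrite -(@gauss_iter_shift s k v (fun=> 1%E))// ?gauss_iter_cst//.
exact: measurable_cst.
Qed.

(** Completing the square: the squared ratio for mean a is exp(a^2 / s^2) times the ratio for mean 2
    a, which integrates to 1. *)
Lemma gauss_lr_sqr s v l : s != 0 ->
  gauss_lr s v l ^+ 2 =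
  expR (\sum_(i < size v) v`_i ^+ 2 / s ^+ 2) * gauss_lr s [seq a *+ 2 | a <- v] l.
Proof.
move=> s0; rewrite /gauss_lr size_map expR_sum -prodrXl -big_split /=.
apply: eq_bigr => i _; rewrite (nth_map 0)// /gauss_lr1 -expRD -expRM_natl.
by congr expR; field.
Qed.

(* Second moment of the likelihood ratio, i.e. one plus the chi-square divergence. *)
Lemma gauss_iter_lr_sqr s k v : s != 0 -> size v = k ->
  gauss_iter s k (fun l => (gauss_lr s v l ^+ 2)%:E) =
  (expR (\sum_(i < size v) v`_i ^+ 2 / s ^+ 2))%:E.
Proof.
move=> s0 sv; under eq_gauss_iter do rewrite gauss_lr_sqr// EFinM.
rewrite gauss_iterZ ?expR_ge0//.
- by rewrite gauss_iter_lr ?size_map// mule1.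
- by move=> l; rewrite lee_fin ltW// gauss_lr_gt0.
- by apply/measurable_EFinP; exact: measurable_gauss_lr.
Qed.

End gauss.

(** * A chi-square Fano inequality *)

Section fano.
Context {R : realType}.

(* Weighted AM-GM, 2 L <= eta L^2 + 1 / eta, on the event that the loss is small. *)
Lemma lr_loss_ge (rho eta L f : R) : 0 <= rho -> 0 < eta -> 0 <= L -> 0 <= f ->
  rho * L <= L * f + rho * eta / 2 * L ^+ 2 + rho / (2 * eta) * (f < rho)%R%:R.
Proof.
move=> r0 e0 L0 f0; have [fr|rf] /= := ltP f rho; last first.
  have : L * rho <= L * f by rewrite ler_wpM2l.
  have : 0 <= rho * eta / 2 * L ^+ 2 by rewrite mulr_ge0 ?sqr_ge0 ?mulr_ge0 ?(ltW e0).
  rewrite mulr0; lra.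
have h : 0 <= rho / (2 * eta) * (eta * L - 1) ^+ 2.
  by rewrite mulr_ge0 ?sqr_ge0// divr_ge0// mulr_ge0// ltW.
have Lf : 0 <= L * f by rewrite mulr_ge0.
suff -> : rho * L = rho * eta / 2 * L ^+ 2 + rho / (2 * eta) * 1
                    - rho / (2 * eta) * (eta * L - 1) ^+ 2 by lra.
by field; rewrite gt_eqF.
Qed.

(* A chi-square version of Fano's inequality: the reference law is pure noise,
   and at most B of the hypotheses can be compatible with any observation. *)
Lemma chi2_fano (s : R) k (I : eqType) (r : seq I) (v : I -> seq R)
    (f : I -> seq R -> R) (rho B D : R) :
  s != 0 -> 0 < rho -> (0 < size r)%N -> (forall i, size (v i) = k) ->
  (forall i, \sum_(j < size (v i)) (v i)`_j ^+ 2 / s ^+ 2 <= D) ->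
  (forall i l, 0 <= f i l) ->
  (forall i, measurable_fun [set: k.-tuple R] (fun t : k.-tuple R => f i t)) ->
  (forall l, (count (fun i => f i l < rho) r)%:R <= B) ->
  B * expR D <= (size r)%:R / 8 ->
  exists2 i, i \in r &
    ((rho / 2)%:E <= gauss_iter s k (fun l => (f i (seq_add (v i) l))%:E))%E.
Proof.
move=> s0 r0 rn0 sv vD f0 mf fB BD.
apply: contrapT => /forall2NP noi.
(* Since E L^2 <= exp D, this [eta] makes each quadratic term at most rho / 4, and the indicator
   terms add up to at most rho B exp D <= rho N / 8 for N hypotheses. If every risk were below rho /
   2, then rho N <= (1/2 + 1/4 + 1/8) rho N, a contradiction. *)
pose eta := expR (- D) / 2.
have eta0 : 0 < eta by rewrite divr_gt0 ?expR_gt0.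
pose L i l := gauss_lr s (v i) l.
have L0 i l : 0 <= L i l by exact/ltW/gauss_lr_gt0.
have mL i : measurable_fun [set: k.-tuple R] (fun t : k.-tuple R => L i t).
  exact: measurable_gauss_lr.
pose risk i := gauss_iter s k (fun l => (f i (seq_add (v i) l))%:E).
have riskE i : risk i = gauss_iter s k (fun l => (L i l * f i l)%:E).
  rewrite /risk (@gauss_iter_shift _ s k (v i) (fun l => (f i l)%:E))//.
  - by move=> l; rewrite lee_fin.
  - exact/measurable_EFinP.
pose g1 i l := (rho * L i l)%:E.
pose g2 i l := ((L i l * f i l)%:E + (rho * eta / 2 * L i l ^+ 2)%:E)%E.
have g10 i l : (0 <= g1 i l)%E by rewrite lee_fin mulr_ge0// ltW.
have q0 i l : (0 <= (rho * eta / 2 * L i l ^+ 2)%:E)%E.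
  by rewrite lee_fin mulr_ge0 ?sqr_ge0// !mulr_ge0 ?(ltW r0) ?(ltW eta0).
have Lf0 i l : (0 <= (L i l * f i l)%:E)%E by rewrite lee_fin mulr_ge0.
have g20 i l : (0 <= g2 i l)%E by rewrite adde_ge0.
have mg1 i : tuple_measurable k (g1 i).
  apply/measurable_EFinP; exact: (measurable_funM (measurable_cst _) (mL i)).
have mLf i : tuple_measurable k (fun l => (L i l * f i l)%:E).
  apply/measurable_EFinP; exact: (measurable_funM (mL i) (mf i)).
have mq i : tuple_measurable k (fun l => (rho * eta / 2 * L i l ^+ 2)%:E).
  apply/measurable_EFinP.
  exact: (measurable_funM (measurable_cst _) (measurable_funX 2 (mL i))).
have mg2 i : tuple_measurable k (g2 i) by exact: (emeasurable_funD (mLf i) (mq i)).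
pose K := rho / (2 * eta) * B.
have B0 : 0 <= B by exact: le_trans (ler0n _ _) (fB [::]).
have K0 : 0 <= K by rewrite mulr_ge0// divr_ge0 ?mulr_ge0 ?(ltW r0) ?(ltW eta0).
have mK : tuple_measurable k (fun=> K%:E) by exact: measurable_cst.
have le12 : (gauss_iter s k (fun l => \sum_(i <- r) g1 i l) <=
             gauss_iter s k (fun l => (\sum_(i <- r) g2 i l) + K%:E))%E.
  apply: le_gauss_iter.
  - by move=> l; exact: sume_ge0.
  - move=> l; rewrite /g1 /g2.
    under [in leRHS]eq_bigr do rewrite -EFinD.
    rewrite !sumEFin -EFinD lee_fin.
    apply: (@le_trans _ _ (\sum_(i <- r) (L i l * f i l + rho * eta / 2 * L i l ^+ 2
              + rho / (2 * eta) * (f i l < rho)%R%:R))).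
      by apply: ler_sum => i _; apply: lr_loss_ge => //; exact: ltW.
    rewrite big_split /= lerD2l -mulr_sumr ler_wpM2l//.
      by rewrite divr_ge0 ?mulr_ge0 ?(ltW r0) ?(ltW eta0).
    by apply: le_trans (fB l); rewrite -natr_sum -sumn_count sumnE big_map.
  - exact: emeasurable_sum.
  - by apply: emeasurable_funD => //; exact: emeasurable_sum.
move: le12; rewrite gauss_iter_sum// gauss_iterD//; last 2 first.
- by move=> l; exact: sume_ge0.
- exact: emeasurable_sum.
rewrite gauss_iter_cst gauss_iter_sum//.
under eq_bigr => i _.
  rewrite /g1; under eq_gauss_iter do rewrite EFinM.
  rewrite gauss_iterZ ?(ltW r0)//; last 2 first.
  - by move=> l; rewrite lee_fin.
  - exact/measurable_EFinP.
  rewrite gauss_iter_lr// mule1; over.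
rewrite /g2; under [X in (_ <= X + _)%E]eq_bigr => i _.
  rewrite gauss_iterD// -riskE.
  under eq_gauss_iter do rewrite EFinM.
  rewrite gauss_iterZ ?mulr_ge0 ?(ltW r0) ?(ltW eta0)//; last 2 first.
  - by move=> l; rewrite lee_fin sqr_ge0.
  - by apply/measurable_EFinP/measurable_funX.
  rewrite gauss_iter_lr_sqr//; over.
apply/negP; rewrite -ltNge.
apply: (@le_lt_trans _ _ (\sum_(i <- r) (rho / 2 + rho / 4)%:E + K%:E)%E).
  rewrite leeD2r// big_seq [leRHS]big_seq; apply: lee_sum => i ir.
  rewrite EFinD; apply: leeD.
    by case: (noi i) => // /negP; rewrite -ltNge => /ltW.
  rewrite -EFinM lee_fin /eta.
  apply: (@le_trans _ _ (rho * (expR (- D) / 2) / 2 * expR D)).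
    by rewrite ler_wpM2l ?ler_expR// ?mulr_ge0 ?expR_ge0 ?(ltW r0).
  have := expRxMexpNx_1 D; set x := expR D; set y := expR (- D) => xy.
  have -> : rho * (y / 2) / 2 * x = rho / 4 * (x * y) by field.
  by rewrite xy mulr1.
rewrite !sumEFin -EFinD lte_fin !big_const_seq !count_predT !iter_addr !addr0.
have -> : K = rho * (B * expR D).
  by rewrite /K /eta expRN; field; rewrite gt_eqF ?expR_gt0.
have : rho * (B * expR D) <= rho * ((size r)%:R / 8) by rewrite ler_wpM2l// ltW.
rewrite -[rho *+ _]mulr_natr -[(_ + _) *+ _]mulr_natr.
have : 0 < rho * (size r)%:R by rewrite mulr_gt0// ltr0n.
lra.
Qed.

End fano.

(** * The two-to-infinity distance *)

Section rownorm.
Context {R : realType}.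

Lemma sum_sqr_ge0 (I : finType) (a : I -> R) : 0 <= \sum_i a i ^+ 2.
Proof. by apply: sumr_ge0 => i _; exact: sqr_ge0. Qed.

Lemma Cauchy_Schwarz_sum (I : finType) (a b : I -> R) :
  (\sum_i a i * b i) ^+ 2 <= (\sum_i a i ^+ 2) * (\sum_i b i ^+ 2).
Proof.
set A := \sum_i a i ^+ 2; set B := \sum_i b i ^+ 2; set C := \sum_i a i * b i.
have [B0|B0] := eqVneq B 0.
  have b0 i : b i = 0.
    by apply/eqP; rewrite -sqrf_eq0; apply/eqP; move/psumr_eq0P : B0; apply => // j _; exact: sqr_ge0.
  by rewrite B0 mulr0 /C big1 ?expr0n// => i _; rewrite b0 mulr0.
have Bgt0 : 0 < B by rewrite lt_def B0 sum_sqr_ge0.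
have : 0 <= \sum_i (B * a i - C * b i) ^+ 2 by exact: sum_sqr_ge0.
have E x y : \sum_i (x * a i - y * b i) ^+ 2 = x ^+ 2 * A + y ^+ 2 * B - 2 * x * y * C.
  by rewrite !mulr_sumr -big_split -sumrB /=; apply: eq_bigr => i _; ring.
rewrite E (_ : _ - _ = B * (A * B - C ^+ 2)); last by ring.
by rewrite pmulr_rge0// subr_ge0.
Qed.

Lemma sqrt_sum_sqrD (I : finType) (a b : I -> R) :
  Num.sqrt (\sum_i (a i + b i) ^+ 2) <=
  Num.sqrt (\sum_i a i ^+ 2) + Num.sqrt (\sum_i b i ^+ 2).
Proof.
set A := \sum_i a i ^+ 2; set B := \sum_i b i ^+ 2; set C := \sum_i a i * b i.
rewrite -[leRHS]ger0_norm ?addr_ge0 ?sqrtr_ge0// -sqrtr_sqr; apply: ler_wsqrtr.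
have -> : \sum_i (a i + b i) ^+ 2 = A + B + 2 * C.
  by rewrite /A /B /C mulr_sumr -!big_split /=; apply: eq_bigr => i _; ring.
have CAB : C <= Num.sqrt A * Num.sqrt B.
  rewrite -sqrtrM ?sum_sqr_ge0//; apply: le_trans (ler_norm C) _.
  by rewrite -sqrtr_sqr ler_wsqrtr// Cauchy_Schwarz_sum.
rewrite sqrrD !sqr_sqrtr ?sum_sqr_ge0//; lra.
Qed.

Lemma norm2inf_ge0 n m (A : 'M[R]_(n, m)) : 0 <= norm2inf A.
Proof. exact: bigmax_ge_id. Qed.

Lemma row_le_norm2inf n m (A : 'M[R]_(n, m)) i :
  Num.sqrt (\sum_j A i j ^+ 2) <= norm2inf A.
Proof. exact: (le_bigmax _ (fun i => Num.sqrt (\sum_j A i j ^+ 2))). Qed.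

Lemma norm2inf_le n m (A : 'M[R]_(n, m)) b : 0 <= b ->
  (forall i, \sum_j A i j ^+ 2 <= b ^+ 2) -> norm2inf A <= b.
Proof.
move=> b0 Ab; apply: bigmax_le => // i _.
by rewrite -[leRHS](ger0_norm b0) -sqrtr_sqr ler_wsqrtr.
Qed.

Lemma row_lt_norm2inf n m (A : 'M[R]_(n, m)) b i : norm2inf A < b ->
  \sum_j A i j ^+ 2 < b ^+ 2.
Proof.
move=> Ab; have := le_lt_trans (row_le_norm2inf A i) Ab.
have b0 : 0 < b by exact: le_lt_trans (norm2inf_ge0 A) Ab.
move=> h; rewrite -[ltLHS]sqr_sqrtr ?sum_sqr_ge0//.
by rewrite ltr_pXn2r ?nnegrE ?sqrtr_ge0 ?(ltW b0).
Qed.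

Lemma norm2infD n m (A B : 'M[R]_(n, m)) : norm2inf (A + B) <= norm2inf A + norm2inf B.
Proof.
apply: bigmax_le => [|i _]; first by rewrite addr_ge0 ?norm2inf_ge0.
under eq_bigr do rewrite mxE.
by apply: le_trans (sqrt_sum_sqrD _ _) _; rewrite lerD ?row_le_norm2inf.
Qed.

Lemma sum_row_sqrE n m (A : 'M[R]_(n, m)) i : \sum_j A i j ^+ 2 = (A *m A^T) i i.
Proof. by rewrite mxE; apply: eq_bigr => j _; rewrite mxE expr2. Qed.

Lemma norm2inf_mulmx_orthogonal n m (A : 'M[R]_(n, m)) G : orthogonal_mx G ->
  norm2inf (A *m G) = norm2inf A.
Proof.
move=> /mulmx1C GG; apply: eq_bigr => i _; congr Num.sqrt.
by rewrite !sum_row_sqrE trmx_mul mulmxA -(mulmxA A) GG mulmx1.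
Qed.

Lemma d2inf_has_inf n m (U1 U2 : 'M[R]_(n, m)) :
  has_inf [set norm2inf (U2 - U1 *m G) | G in [set G | orthogonal_mx G]].
Proof.
split.
  exists (norm2inf (U2 - U1 *m 1%:M)); exists 1%:M => //=.
  by rewrite /orthogonal_mx trmx1 mulmx1.
by exists 0 => _ [G _ <-]; exact: norm2inf_ge0.
Qed.

Lemma d2inf_le n m (U1 U2 : 'M[R]_(n, m)) G : orthogonal_mx G ->
  d2inf U1 U2 <= norm2inf (U2 - U1 *m G).
Proof.
by move=> oG; apply: inf_lbound; [have [_] := d2inf_has_inf U1 U2|exists G].
Qed.

Lemma d2inf_lt n m (U1 U2 : 'M[R]_(n, m)) b : d2inf U1 U2 < b ->
  exists2 G, orthogonal_mx G & norm2inf (U2 - U1 *m G) < b.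
Proof. by case/(inf_lt (d2inf_has_inf U1 U2).1) => _ [G oG <-] ?; exists G. Qed.

Lemma d2inf_ge0 n m (U1 U2 : 'M[R]_(n, m)) : 0 <= d2inf U1 U2.
Proof.
apply: lb_le_inf; first by have [] := d2inf_has_inf U1 U2.
by move=> _ [G _ <-]; exact: norm2inf_ge0.
Qed.

(** Orthogonal factors preserve row norms, so the triangle inequality applies with the same G on
    both sides. *)
Lemma d2inf_lipschitz n m (W W' U : 'M[R]_(n, m)) :
  d2inf W U <= norm2inf (W' - W) + d2inf W' U.
Proof.
rewrite -lerBlDl; apply: lb_le_inf; first by have [] := d2inf_has_inf W' U.
move=> _ [G oG <-]; rewrite lerBlDl; apply: le_trans (d2inf_le W U oG) _.
rewrite -(norm2inf_mulmx_orthogonal (W' - W) oG).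
apply: le_trans _ (norm2infD _ _); rewrite mulmxBl.
by rewrite le_eqVlt; apply/orP; left; apply/eqP; congr norm2inf; rewrite [RHS]addrC addrA subrK.
Qed.

(** * Measurability of the two-to-infinity distance *)

Lemma ratr_approx_norm2inf n m (A : 'M[R]_(n, m)) e : 0 < e ->
  exists W : 'M[rat]_(n, m), norm2inf (A - map_mx ratr W) <= e.
Proof.
(* The successor keeps [d] positive when m = 0; m d^2 <= e^2 still holds. *)
move=> e0; pose d := e / m.+1%:R.
have d0 : 0 < d by rewrite divr_gt0.
have ex i j : exists q : rat, `|A i j - ratr q| <= d.
  have /rat_in_itvoo[q] : A i j - d < A i j + d by lra.
  rewrite in_itv /= => /andP[h1 h2]; exists q; rewrite ler_norml; lra.
pose W : 'M[rat]_(n, m) := \matrix_(i, j) projT1 (cid (ex i j)).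
exists W; apply: norm2inf_le; first exact: ltW.
move=> i; apply: (@le_trans _ _ (\sum_(j < m) d ^+ 2)).
  apply: ler_sum => j _; rewrite !mxE; case: cid => q /= h.
  by rewrite -real_normK ?num_real// ler_pXn2r ?nnegrE// ltW.
rewrite sumr_const card_ord -[leLHS]mulr_natl /d exprMn mulrCA ler_piMr ?sqr_ge0//.
rewrite exprVn ler_pdivrMr ?exprn_gt0// mul1r -natrX ler_nat.
by rewrite expnS expn1 (leq_trans (leqnSn m))// leq_pmulr.
Qed.

Lemma measurable_bigmaxr d (T : measurableType d) (I : Type) (r : seq I) (h : I -> T -> R) :
  (forall i, measurable_fun [set: T] (h i)) ->
  measurable_fun [set: T] (fun t => \big[Num.max/0]_(i <- r) h i t).
Proof.
move=> mh; elim: r => [|i r IH].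
  by under eq_fun do rewrite big_nil; exact: measurable_cst.
by under eq_fun do rewrite big_cons; exact: measurable_maxr.
Qed.

Lemma measurable_norm2inf d (T : measurableType d) n m (A : T -> 'M[R]_(n, m)) :
  (forall i j, measurable_fun [set: T] (fun t => A t i j)) ->
  measurable_fun [set: T] (fun t => norm2inf (A t)).
Proof.
move=> mA; apply: measurable_bigmaxr => i.
apply: (measurableT_comp (f := @Num.sqrt R)).
  by apply: continuous_measurable_fun; exact: sqrt_continuous.
by apply: measurable_sum => j; exact: measurable_funX.
Qed.

(** The infimum runs over an uncountable group. By the Lipschitz bound, each strict sublevel set is
    a countable union, over rational matrices W, of sublevel sets of the measurable function |A - W|
    + d(W, U). *)
Lemma measurable_d2inf d (T : measurableType d) n m (A : T -> 'M[R]_(n, m)) U :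
  (forall i j, measurable_fun [set: T] (fun t => A t i j)) ->
  measurable_fun [set: T] (fun t => d2inf (A t) U).
Proof.
move=> mA _; apply: (measurability _ (RGenInftyO.measurableE R)) => //.
move=> _ [_ [a ->] <-]; rewrite setTI.
pose F (W : 'M[rat]_(n, m)) := [set t | norm2inf (A t - map_mx ratr W) +
  d2inf (map_mx ratr W) U < a].
rewrite (_ : _ @^-1` _ = \bigcup_W F W).
  apply: countable_bigcupT_measurable; first exact: countableP.
  move=> W; have mN : measurable_fun [set: T]
      (fun t => norm2inf (A t - map_mx ratr W) + d2inf (map_mx ratr W) U).
    apply: measurable_funD => //; apply: measurable_norm2inf => i j.
    by under eq_fun do rewrite !mxE; exact: measurable_funB.
  rewrite (_ : F W = setT `&` (fun t => norm2inf (A t - map_mx ratr W) +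
    d2inf (map_mx ratr W) U) @^-1` `]-oo, a[%classic).
    by apply: mN => //; exact: measurable_itv.
  by rewrite setTI; apply/seteqP; split => t /=; rewrite in_itv.
apply/seteqP; split => t /=; rewrite in_itv /=.
  (* A third of the gap suffices, because the approximation error enters twice. *)
  move=> ta; have e0 : 0 < (a - d2inf (A t) U) / 3 by rewrite divr_gt0// subr_gt0.
  have [W hW] := ratr_approx_norm2inf (A t) e0; exists W => //=.
  have := d2inf_lipschitz (map_mx ratr W) (A t) U; rewrite /F /=; lra.
move=> [W _]; rewrite /F /= => h.
have := d2inf_lipschitz (A t) (map_mx ratr W) U.
suff -> : norm2inf (map_mx ratr W - A t) = norm2inf (A t - map_mx ratr W) by lra.
apply: eq_bigr => i _; congr Num.sqrt; apply: eq_bigr => j _.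
by rewrite !mxE -sqrrN opprB.
Qed.

End rownorm.

(** * Whitening *)

Section frobenius.
Context {R : realType}.

Definition sqfrob n m (A : 'M[R]_(n, m)) : R := \sum_i \sum_j A i j ^+ 2.

Lemma sqfrob_ge0 n m (A : 'M[R]_(n, m)) : 0 <= sqfrob A.
Proof. by apply: sumr_ge0 => i _; exact: sum_sqr_ge0. Qed.

Lemma sqfrobE n m (A : 'M[R]_(n, m)) : sqfrob A = \tr (A *m A^T).
Proof. by apply: eq_bigr => i _; rewrite sum_row_sqrE. Qed.

Lemma sqfrob_tr n m (A : 'M[R]_(n, m)) : sqfrob A^T = sqfrob A.
Proof. by rewrite !sqfrobE trmxK mxtrace_mulC. Qed.

Lemma sqfrobN n m (A : 'M[R]_(n, m)) : sqfrob (- A) = sqfrob A.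
Proof. by rewrite !sqfrobE linearN /= mulmxN mulNmx opprK. Qed.

Lemma sqfrobZ n m a (A : 'M[R]_(n, m)) : sqfrob (a *: A) = a ^+ 2 * sqfrob A.
Proof. by rewrite !sqfrobE linearZ /= -scalemxAl -scalemxAr scalerA mxtraceZ expr2. Qed.

Lemma sqfrobD n m (A B : 'M[R]_(n, m)) : sqfrob (A + B) <= 2 * (sqfrob A + sqfrob B).
Proof.
rewrite -big_split mulr_sumr; apply: ler_sum => i _.
rewrite -big_split mulr_sumr; apply: ler_sum => j _ /=.
by rewrite mxE; have := sqr_ge0 (A i j - B i j); lra.
Qed.

Lemma sqfrobD3 n m (A B C : 'M[R]_(n, m)) :
  sqfrob (A + B + C) <= 3 * (sqfrob A + sqfrob B + sqfrob C).
Proof.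
rewrite -!big_split mulr_sumr; apply: ler_sum => i _.
rewrite -!big_split mulr_sumr; apply: ler_sum => j _ /=; rewrite !mxE.
have := sqr_ge0 (A i j - B i j); have := sqr_ge0 (A i j - C i j).
have := sqr_ge0 (B i j - C i j); lra.
Qed.

Lemma sqfrob_col_mx n1 n2 m (A : 'M[R]_(n1, m)) (B : 'M[R]_(n2, m)) :
  sqfrob (col_mx A B) = sqfrob A + sqfrob B.
Proof.
rewrite /sqfrob big_split_ord /=; congr (_ + _); apply: eq_bigr => i _;
by apply: eq_bigr => j _; rewrite ?col_mxEu ?col_mxEd.
Qed.

Lemma sqfrob_isometry n m k (U : 'M[R]_(n, m)) (B : 'M[R]_(m, k)) :
  U^T *m U = 1%:M -> sqfrob (U *m B) = sqfrob B.
Proof.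
move=> U1; rewrite -sqfrob_tr -[RHS]sqfrob_tr !sqfrobE !trmxK trmx_mul.
by rewrite mulmxA -(mulmxA _ U^T) U1 mulmx1.
Qed.

(** T is an inverse square root of 1 + V^T V up to a rotation on the right; equivalently [T; V T]
    has orthonormal columns. *)
Definition whitens q r (V : 'M[R]_(q, r)) (T : 'M[R]_r) : Prop :=
  T^T *m (1%:M + V^T *m V) *m T = 1%:M.

(* One rank-one update per row of V: for a row w of squared norm b,
   1 + w^T w is whitened by 1 - a w^T w with a = 1 / (s (s + 1)), s^2 = 1 + b. *)
Lemma whitens_row r (w : 'rV[R]_r) :
  exists a, whitens w (1%:M - a *: (w^T *m w)).
Proof.
set P := w^T *m w; set b := \sum_j w ord0 j ^+ 2.
have b0 : 0 <= b by exact: sum_sqr_ge0.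
have PP : P *m P = b *: P.
  rewrite /P mulmxA -(mulmxA w^T) [w *m w^T]mx11_scalar -sum_row_sqrE.
  by rewrite -mulmxA mul_scalar_mx scalemxAr.
pose s := Num.sqrt (1 + b); pose a := (s * (s + 1))^-1.
have s0 : 0 < s by rewrite sqrtr_gt0 ltr_pwDl.
have bE : b = s ^+ 2 - 1 by rewrite sqr_sqrtr ?addr_ge0// addrC addKr.
have trP : P^T = P by rewrite trmx_mul trmxK.
exists a; rewrite /whitens -/P (_ : (1%:M - a *: P)^T = 1%:M - a *: P); last first.
  by apply/matrixP => i j; rewrite -{2}trP !mxE eq_sym.
clearbody P.
have c0 : 1 - (1 + b) * (2 * a - a ^+ 2 * b) = 0.
  by rewrite bE /a; field; rewrite ?gt_eqF// ltr_wpDl// ltW.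
rewrite !(mulmxBl, mulmxDr, mulmxBr, mulmxDl, mulmx1, mul1mx, mulmxN) -!scalemxAr -!scalemxAl.
rewrite !PP -!scalemxAl !PP !scalerA.
rewrite -[RHS]addr0 -[in RHS](scale0r P) -c0.
by apply/matrixP => i j; rewrite !mxE; ring.
Qed.

(** Once T2 has whitened the lower block, what remains is 1 plus the Gram matrix of V1 T2, so the
    whitening factors compose. This allows an induction on the rows. *)
Lemma whitens_col_mx q1 q2 r (V1 : 'M[R]_(q1, r)) (V2 : 'M[R]_(q2, r)) T1 T2 :
  whitens V2 T2 -> whitens (V1 *m T2) T1 -> whitens (col_mx V1 V2) (T2 *m T1).
Proof.
rewrite /whitens => w2 w1.
rewrite tr_col_mx mul_row_col trmx_mul.
rewrite (_ : T1^T *m T2^T *m _ *m _ = T1^T *m (T2^T *m (1%:M + V2^T *m V2) *m T2 +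
   (V1 *m T2)^T *m (V1 *m T2)) *m T1); first by rewrite w2.
by rewrite trmx_mul !(mulmxDr, mulmxDl, mulmx1, mulmxA) [X in _ = X]addrAC addrA.
Qed.

Lemma whitens_exists q r (V : 'M[R]_(q, r)) : exists T, whitens V T.
Proof.
elim: q V => [|q IH] V.
  exists 1%:M; rewrite /whitens trmx1 mulmx1 mul1mx.
  by rewrite (_ : _ *m _ = 0) ?addr0//; apply/matrixP => i j; rewrite !mxE big_ord0.
have [T2 w2] := IH (dsubmx (V : 'M[R]_(1 + q, r))).
have [a w1] := whitens_row (usubmx (V : 'M[R]_(1 + q, r)) *m T2).
have := whitens_col_mx w2 w1; rewrite vsubmxK => w; exact: ex_intro w.
Qed.

(** Lets the rotations in [d2inf] be absorbed into the whitening factor. *)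
Lemma whitens_orthogonal q r (V : 'M[R]_(q, r)) T G :
  whitens V T -> orthogonal_mx G -> whitens V (T *m G).
Proof.
rewrite /whitens /orthogonal_mx trmx_mul => w G1.
rewrite (_ : G^T *m T^T *m _ *m _ = G^T *m (T^T *m (1%:M + V^T *m V) *m T) *m G).
  by rewrite w mulmx1.
by rewrite !mulmxA.
Qed.

Section whitened.
Context (q r : nat) (V : 'M[R]_(q, r)) (T : 'M[R]_r) (wT : whitens V T).

Lemma whitens_isometry : (col_mx T (V *m T))^T *m col_mx T (V *m T) = 1%:M.
Proof.
by rewrite tr_col_mx mul_row_col trmx_mul -[RHS]wT mulmxDr mulmxDl mulmx1 !mulmxA.
Qed.

(** Because [T; V T] is an isometry, T and V T are both contractions for the Frobenius norm. *)
Lemma whitens_sqfrob m (B : 'M[R]_(r, m)) :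
  sqfrob (T *m B) + sqfrob (V *m T *m B) = sqfrob B.
Proof. by rewrite -sqfrob_col_mx -mul_col_mx sqfrob_isometry// whitens_isometry. Qed.

Lemma sqfrob_whitens m (B : 'M[R]_(r, m)) : sqfrob (T *m B) <= sqfrob B.
Proof. by rewrite -[leRHS]whitens_sqfrob lerDl sqfrob_ge0. Qed.

Lemma sqfrob_mul_whitens m (B : 'M[R]_(r, m)) : sqfrob (V *m T *m B) <= sqfrob B.
Proof. by rewrite -[leRHS]whitens_sqfrob lerDr sqfrob_ge0. Qed.

Lemma sqfrob_whitens_tr m (B : 'M[R]_(m, r)) : sqfrob (B *m T^T) <= sqfrob B.
Proof. by rewrite -sqfrob_tr trmx_mul trmxK -[leRHS]sqfrob_tr sqfrob_whitens. Qed.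

(** Expand the nonnegative squared norm of B - B T T^T: the cross term is twice that of B T, while
    the last term, that of B T T^T, is at most that of B T. *)
Lemma sqfrob_whitensr m (B : 'M[R]_(m, r)) : sqfrob (B *m T) <= sqfrob B.
Proof.
have h : sqfrob (B - B *m T *m T^T) = sqfrob B - 2 * sqfrob (B *m T) + sqfrob (B *m T *m T^T).
  rewrite !sqfrobE linearB /= !trmx_mul !trmxK !(mulmxBl, mulmxBr) !linearB /= !mulmxA.
  ring.
have := sqfrob_ge0 (B - B *m T *m T^T); rewrite h.
have := sqfrob_whitens_tr (B *m T); lra.
Qed.

Lemma whitens_inv : T *m T^T *m (1%:M + V^T *m V) = 1%:M.
Proof. by move/mulmx1C : wT; rewrite mulmxA. Qed.

(** T T^T inverts 1 + V^T V, so the defect is V T T^T V^T V, and the contractions strip off V T and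
    T^T. *)
Lemma sqfrob_whitens_defect : sqfrob (V *m (1%:M - T *m T^T)) <= sqfrob (V^T *m V).
Proof.
have -> : 1%:M - T *m T^T = T *m T^T *m (V^T *m V).
  by rewrite -{1}whitens_inv mulmxDr mulmx1 addrC addKr.
rewrite -!mulmxA mulmxA; apply: le_trans (sqfrob_mul_whitens _) _.
rewrite -sqfrob_tr !trmx_mul !trmxK; exact: sqfrob_whitensr.
Qed.

End whitened.

Lemma whitens_separation q r (V V' : 'M[R]_(q, r)) T T' E :
  whitens V T -> whitens V' T' ->
  sqfrob (T - T') + sqfrob (V *m T - V' *m T') <= E ->
  sqfrob (V - V') <= 3 * (sqfrob (V^T *m V) + sqfrob (V'^T *m V') + 2 * E).
Proof.
move=> wT wT' hE.
(* V is recovered from V T as V T T^T up to the defect; the difference of the two recovered products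
   telescopes. *)
have -> : V - V' = V *m (1%:M - T *m T^T) + - (V' *m (1%:M - T' *m T'^T)) +
    ((V *m T - V' *m T') *m T^T + V' *m T' *m (T - T')^T).
  rewrite (_ : (T - T')^T = T^T - T'^T); last by rewrite linearB.
  rewrite !(mulmxBl, mulmxBr) !mulmx1 !mulmxA.
  move: (V *m T *m T^T) (V' *m T' *m T'^T) (V' *m T' *m T^T) => x y z.
  by apply/matrixP => i j; rewrite !mxE; ring.
apply: le_trans (sqfrobD3 _ _ _) _; rewrite ler_wpM2l// sqfrobN.
apply: lerD; first by rewrite lerD// sqfrob_whitens_defect.
apply: le_trans (sqfrobD _ _) _; rewrite ler_wpM2l//.
apply: le_trans hE; rewrite [leRHS]addrC; apply: lerD.
  exact: sqfrob_whitens_tr wT _ _.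
by rewrite -[leRHS]sqfrob_tr; exact: sqfrob_mul_whitens wT' _ _.
Qed.

End frobenius.

(** * Incoherent frames *)

Section frame.
Context {R : realType}.

Fixpoint id_stack (K r : nat) : 'M[R]_(K * r, r) :=
  match K with 0%N => 0 | K'.+1 => col_mx 1%:M (id_stack K' r) end.

Lemma id_stack_gram K r : (id_stack K r)^T *m id_stack K r = K%:R%:M.
Proof.
elim: K => [|K IH] /=; first by rewrite mulmx0 raddf0.
by rewrite [(col_mx _ _)^T]tr_col_mx mul_row_col trmx1 mulmx1 IH -raddfD /= -natr1 addrC.
Qed.

Lemma id_stack_row K r i : \sum_j id_stack K r i j ^+ 2 = 1.
Proof.
elim: K i => [|K IH] /=; first by case.
move=> i; case: (@split_ordP r (K * r) i) => k ->.
  under eq_bigr do rewrite col_mxEu mxE.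
  rewrite (bigD1 k)//= eqxx expr1n big1 ?addr0// => j jk.
  by rewrite eq_sym (negbTE jk) expr0n.
by under eq_bigr do rewrite col_mxEd; exact: IH.
Qed.

(** The fixed matrix A of the construction. *)
Definition spread K r : 'M[R]_(K * r, r) := (Num.sqrt K%:R)^-1 *: id_stack K r.

Lemma sqr_invsqrt K : (Num.sqrt (K%:R : R))^-1 ^+ 2 = K%:R^-1.
Proof. by rewrite exprVn sqr_sqrtr. Qed.

Lemma spread_gram K r : (0 < K)%N -> (spread K r)^T *m spread K r = 1%:M.
Proof.
move=> K0; rewrite /spread [(_ *: id_stack K r)^T]linearZ /= -scalemxAl -scalemxAr scalerA id_stack_gram.
by rewrite -expr2 sqr_invsqrt scale_scalar_mx mulVf// pnatr_eq0 -lt0n.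
Qed.

Lemma spread_row K r i : \sum_j spread K r i j ^+ 2 = K%:R^-1.
Proof.
under eq_bigr do rewrite mxE exprMn sqr_invsqrt.
by rewrite -mulr_sumr id_stack_row mulr1.
Qed.

(** The orthonormalised stack U_S; z zero rows pad it to full height. *)
Definition frame K q z r (V : 'M[R]_(q, r)) (T : 'M[R]_r) : 'M[R]_(K * r + q + z, r) :=
  col_mx (col_mx (spread K r *m T) (V *m T)) 0.

Lemma frame_mulmx K q z r (V : 'M[R]_(q, r)) T G :
  frame K z V T *m G = frame K z V (T *m G).
Proof. by rewrite /frame !mul_col_mx mul0mx !mulmxA. Qed.

Lemma frame_gram K q z r (V : 'M[R]_(q, r)) T : (0 < K)%N -> whitens V T ->
  (frame K z V T)^T *m frame K z V T = 1%:M.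
Proof.
move=> K0 wT; rewrite /frame !tr_col_mx !mul_row_col mulmx0 addr0.
rewrite -[RHS](whitens_isometry wT) tr_col_mx mul_row_col; congr (_ + _).
by rewrite trmx_mul mulmxA -(mulmxA T^T) spread_gram// mulmx1.
Qed.

Lemma whitens_row_le q r m (V : 'M[R]_(q, r)) T (X : 'M[R]_(m, r)) i : whitens V T ->
  \sum_j (X *m T) i j ^+ 2 <= \sum_j X i j ^+ 2.
Proof.
have rowE n (Y : 'M[R]_(n, r)) k : \sum_j Y k j ^+ 2 = sqfrob (row k Y).
  by rewrite /sqfrob big_ord1; apply: eq_bigr => j _; rewrite mxE.
by move=> wT; rewrite !rowE row_mul (sqfrob_whitensr wT).
Qed.

Lemma frame_row_le K q z r (V : 'M[R]_(q, r)) T b i : whitens V T ->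
  K%:R^-1 <= b -> (forall k, \sum_j V k j ^+ 2 <= b) ->
  \sum_j frame K z V T i j ^+ 2 <= b.
Proof.
move=> wT Kb Vb; have b0 : 0 <= b by apply: le_trans Kb; rewrite invr_ge0.
rewrite /frame; case: (split_ordP i) => k ->; last first.
  by under eq_bigr do rewrite col_mxEd mxE expr0n; rewrite big1.
under eq_bigr do rewrite col_mxEu.
case: (split_ordP k) => l ->.
  under eq_bigr do rewrite col_mxEu.
  by apply: le_trans (whitens_row_le _ _ wT) _; rewrite spread_row.
under eq_bigr do rewrite col_mxEd.
exact: le_trans (whitens_row_le _ _ wT) (Vb _).
Qed.

(** The top block carries T - T' isometrically, so summing the bounds of the K r + q rows above the
    padding gives the hypothesis of [whitens_separation]. *)
Lemma frame_separation K q z r (V V' : 'M[R]_(q, r)) T T' e : (0 < K)%N ->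
  whitens V T -> whitens V' T' ->
  (forall i, \sum_j (frame K z V T - frame K z V' T') i j ^+ 2 <= e) ->
  sqfrob (V - V') <= 3 * (sqfrob (V^T *m V) + sqfrob (V'^T *m V') +
    2 * ((K * r + q)%:R * e)).
Proof.
move=> K0 wT wT' he; apply: (whitens_separation wT wT').
rewrite -(sqfrob_isometry (T - T') (spread_gram r K0)) -sqfrob_col_mx.
rewrite mulr_natl -[in leRHS](card_ord (K * r + q)) -sumr_const; apply: ler_sum => i _.
apply: le_trans (he (lshift z i)); apply: ler_sum => j _.
rewrite /frame opp_col_mx add_col_mx col_mxEu opp_col_mx add_col_mx.
by rewrite mulmxBr.
Qed.

End frame.

(** * Sign matrices *)

Section signs.
Context {R : realType}.

Definition hamming (I : finType) (S S' : {ffun I -> bool}) : nat :=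
  \sum_i (S i != S' i).

Lemma sum_hamming (I : finType) (S : {ffun I -> bool}) (x : R) :
  \sum_(S' : {ffun I -> bool}) x ^+ hamming S S' = (1 + x) ^+ #|I|.
Proof.
transitivity (\sum_(S' : {ffun I -> bool}) \prod_i x ^+ (S i != S' i)).
  by apply: eq_bigr => S' _; rewrite /hamming expr_sum.
rewrite -(bigA_distr_bigA (fun i b => x ^+ (S i != b))) /=.
rewrite -prodr_const; apply: eq_bigr => i _; rewrite big_bool.
by case: (S i); rewrite ?expr0 ?expr1// addrC.
Qed.

(* Exponential tilting by 2^-hamming, with (17/16)^16 >= 2. *)
Lemma card_hamming_ball (I : finType) (S : {ffun I -> bool}) :
  #|[pred S' | (16 * hamming S S' <= #|I|)%N]|%:R <= (51 / 32 : R) ^+ #|I|.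
Proof.
(* The factor 3/2 per coordinate is the generating function at 1/2; the factor 17/16 compensates the
   weight 2^-h of each point of the ball. *)
have -> : 51 / 32 = (17 / 16 : R) * (1 + 2^-1) by field.
rewrite exprMn -(sum_hamming S) mulr_sumr -sum1_card natr_sum big_mkcond /=.
apply: ler_sum => S' _; rewrite inE; case: ifPn => [h|_]; last first.
  by rewrite mulr_ge0 ?exprn_ge0// ?divr_ge0 ?invr_ge0.
have b17 : (2 : R) <= (17 / 16) ^+ 16 by lra.
rewrite exprVn ler_pdivlMr ?exprn_gt0// mul1r.
apply: (@le_trans _ _ (((17 / 16) ^+ 16) ^+ hamming S S')).
  by apply: lerXn2r => //; rewrite nnegrE; lra.
by rewrite -exprM; apply: ler_weXn2l => //; lra.
Qed.

Definition sgnmx q r (S : {ffun 'I_q * 'I_r -> bool}) : 'M[R]_(q, r) :=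
  \matrix_(i, j) (-1) ^+ S (i, j).

Lemma sgnmx_row q r (S : {ffun 'I_q * 'I_r -> bool}) i :
  \sum_j sgnmx S i j ^+ 2 = r%:R.
Proof.
by under eq_bigr do rewrite mxE sqrr_sign; rewrite sumr_const card_ord.
Qed.

Lemma sqfrob_sgnmxB q r (S S' : {ffun 'I_q * 'I_r -> bool}) :
  sqfrob (sgnmx S - sgnmx S') = 4 * (hamming S S')%:R.
Proof.
rewrite /sqfrob /hamming pair_bigA natr_sum mulr_sumr; apply: eq_bigr => -[i j] _ /=.
rewrite !mxE; case: (S _); case: (S' _) => /=; rewrite ?expr0 ?expr1; ring.
Qed.

(* Flipping the sign at (i, j) negates the summand. *)
Lemma sum_sgnmx4 q r (i i' : 'I_q) (j k : 'I_r) :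
  \sum_(S : {ffun 'I_q * 'I_r -> bool})
    sgnmx S i j * sgnmx S i k * (sgnmx S i' j * sgnmx S i' k) <=
  (2 ^ (q * r) * ((j == k) + (i == i')))%:R.
Proof.
have [jk|jk] := boolP ((j == k) || (i == i')).
  apply: (@le_trans _ _ (\sum_(S : {ffun 'I_q * 'I_r -> bool}) 1)).
    apply: ler_sum => S _; rewrite !mxE.
    by case: (S _); case: (S _); case: (S _); case: (S _); rewrite /= ?expr0 ?expr1; lra.
  rewrite sumr_const card_ffun card_bool card_prod !card_ord ler_nat leq_pmulr//.
  by case/orP : jk => ->; rewrite ?addn1.
move: jk; rewrite negb_or => /andP[jk ii]; rewrite (negbTE jk) (negbTE ii) muln0.
set s := (X in X <= _); suff : s = - s by lra.
pose flip (S : {ffun 'I_q * 'I_r -> bool}) := [ffun p => S p (+) (p == (i, j))].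
have flipK : involutive flip.
  by move=> S; apply/ffunP => p; rewrite !ffunE -addbA addbb addbF.
rewrite {1}/s (reindex_inj (inv_inj flipK)) /= /s -sumrN; apply: eq_bigr => S _.
rewrite !mxE !ffunE eqxx !xpair_eqE eqxx (eq_sym k j) (eq_sym i' i) (negbTE jk) (negbTE ii) /= !addbF.
by rewrite addbT signrN !mulNr.
Qed.

(** Expand the squared Gram entries into products of four signs: only the indices with j = k (r q^2
    of them) or i = i' (r^2 q) contribute. *)
Lemma sum_sqfrob_sgnmx_gram q r :
  \sum_(S : {ffun 'I_q * 'I_r -> bool}) sqfrob ((sgnmx S)^T *m sgnmx S) <=
  (2 ^ (q * r) * (r * q ^ 2 + r ^ 2 * q))%:R.
Proof.
have -> : (\sum_(S : {ffun 'I_q * 'I_r -> bool}) sqfrob ((sgnmx S)^T *m sgnmx S) =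
   \sum_j \sum_k \sum_i \sum_i' \sum_(S : {ffun 'I_q * 'I_r -> bool})
     sgnmx S i j * sgnmx S i k * (sgnmx S i' j * sgnmx S i' k)).
  rewrite exchange_big; apply: eq_bigr => j _.
  rewrite exchange_big; apply: eq_bigr => k _.
  under eq_bigr do rewrite mxE expr2 mulr_suml; rewrite exchange_big; apply: eq_bigr => i _.
  under eq_bigr do rewrite mulr_sumr; rewrite exchange_big; apply: eq_bigr => i' _.
  by apply: eq_bigr => S _; rewrite !mxE.
apply: (@le_trans _ _ (\sum_(j < r) \sum_(k < r) \sum_(i < q) \sum_(i' < q)
   (2 ^ (q * r) * ((j == k) + (i == i')))%:R)).
  by do 4! (apply: ler_sum => ? _); exact: sum_sgnmx4.
under eq_bigr do under eq_bigr do under eq_bigr do rewrite -natr_sum.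
under eq_bigr do under eq_bigr do rewrite -natr_sum.
under eq_bigr do rewrite -natr_sum.
rewrite -natr_sum ler_nat eq_leq//.
have delta n (i : 'I_n) : (\sum_(k < n) (i == k) = 1)%N.
  by rewrite (bigD1 i)//= eqxx big1// => k; rewrite eq_sym => /negbTE ->.
have sumc n c : (\sum_(k < n) c = n * c)%N by rewrite sum_nat_const card_ord.
set c := (2 ^ _)%N.
have E1 (j k : 'I_r) :
    (\sum_(i < q) \sum_(i' < q) c * ((j == k) + (i == i')) = c * (q ^ 2 * (j == k) + q))%N.
  under eq_bigr do rewrite -big_distrr /= big_split /= sumc delta.
  rewrite sumc mulnCA; congr (_ * _)%N; lia.
under eq_bigr do under eq_bigr do rewrite E1.
under eq_bigr do rewrite -big_distrr /= big_split /= -big_distrr /= delta sumc.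
rewrite sumc mulnCA; congr (_ * _)%N; lia.
Qed.

(** Markov's inequality: as r <= q, the mean is at most 2 r q^2, half the threshold. *)
Lemma card_balanced_signs q r : (0 < r)%N -> (r <= q)%N ->
  (2 ^ (q * r) <= 2 * #|[pred S : {ffun 'I_q * 'I_r -> bool} |
     (sqfrob ((sgnmx S)^T *m sgnmx S) <= 4 * r%:R * q%:R ^+ 2)%R]|)%N.
Proof.
move=> r0 rq; set P := [pred S | _].
have cE : (#|P| + #|[predC P]| = 2 ^ (q * r))%N.
  by rewrite cardC card_ffun card_bool card_prod !card_ord.
have rq0 : 0 < r%:R * q%:R ^+ 2 :> R.
  by rewrite mulr_gt0 ?exprn_gt0 ?ltr0n// (leq_trans r0).
suff : (2 * #|[predC P]| <= 2 ^ (q * r))%N by lia.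
rewrite -(ler_nat R) -(ler_pM2r rq0) natrM.
have : #|[predC P]|%:R * (4 * r%:R * q%:R ^+ 2) <=
    (2 ^ (q * r) * (r * q ^ 2 + r ^ 2 * q))%:R :> R.
  apply: le_trans (sum_sqfrob_sgnmx_gram q r).
  rewrite -sum1_card natr_sum mulr_suml big_mkcond /=; apply: ler_sum => S _.
  rewrite inE; case: ifPn => [|_]; last exact: sqfrob_ge0.
  by rewrite inE -ltNge mul1r => /ltW.
have : (2 ^ (q * r) * (r * q ^ 2 + r ^ 2 * q))%:R <=
    (2 ^ (q * r) * (2 * (r * q ^ 2)))%:R :> R.
  rewrite ler_nat leq_mul2l; apply/orP; right; nia.
rewrite !natrM !natrX; set x := 2 ^+ _; lra.
Qed.

End signs.

(** * The packing *)

Section observation.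
Context {R : realType}.

Definition upper_seq n (M : 'M[R]_n) : seq R := [seq M p.1 p.2 | p <- upper_pairs n].

Lemma mem_upper_pairs n (p : 'I_n * 'I_n) : (p \in upper_pairs n) = (p.1 <= p.2)%N.
Proof.
rewrite mem_filter; case: p => i j /=; case: (i <= j)%N => //=.
by rewrite allpairs_f// mem_enum.
Qed.

(** Turns adding the signal into a shift of the independent entries, the form used by
    [chi2_fano]. *)
Lemma upper_seqD n (M : 'M[R]_n) l : M^T = M -> size l = size (upper_pairs n) ->
  M + sym_of_seq n l = sym_of_seq n (seq_add (upper_seq M) l).
Proof.
move=> MT sl; apply/matrixP => i j; rewrite !mxE.
set p := if _ then _ else _.
have pin : p \in upper_pairs n.
  by rewrite mem_upper_pairs /p; case: (leqP i j) => [|/ltnW].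
have ip : (index p (upper_pairs n) < size (upper_pairs n))%N by rewrite index_mem.
rewrite nth_seq_add ?sl// addrC; congr (_ + _).
rewrite (nth_map p)// nth_index// /p; case: (leqP i j) => // _.
by rewrite -[in RHS]MT mxE.
Qed.

Lemma sum_upper_seq n (M : 'M[R]_n) :
  \sum_(i < size (upper_seq M)) (upper_seq M)`_i ^+ 2 <= sqfrob M.
Proof.
rewrite -(big_mkord xpredT (fun i => (upper_seq M)`_i ^+ 2)) -(big_nth 0 xpredT (fun x => x ^+ 2)).
rewrite big_map big_filter big_mkcond /=.
apply: (@le_trans _ _ (\sum_(p <- [seq (i, j) | i <- enum 'I_n, j <- enum 'I_n]) M p.1 p.2 ^+ 2)).
  by apply: ler_sum => p _; case: ifP => // _; exact: sqr_ge0.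
rewrite big_allpairs /= /sqfrob -big_enum le_eqVlt; apply/orP; left; apply/eqP.
by apply: eq_bigr => i _; rewrite -big_enum.
Qed.

Lemma sqfrob_gram n r (U : 'M[R]_(n, r)) (lam : R) : U^T *m U = 1%:M ->
  sqfrob (U *m (lam%:M : 'M[R]_r) *m U^T) = lam ^+ 2 * r%:R.
Proof.
move=> U1; rewrite mul_mx_scalar -scalemxAl sqfrobZ sqfrob_isometry//.
by rewrite sqfrobE trmxK U1 mxtrace1.
Qed.

End observation.

Section packing.
Context {R : realType}.

(** With exp(1/64) <= 64/63, the base is 51/32 * 64/63 = 2 * 17/21, and (17/21)^16 <= 1/16 pays for
    the halving and the factor 1/8. *)
Lemma fano_exponent (N : nat) (D : R) (G : nat) : (16 <= N)%N -> D <= N%:R / 64 ->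
  (2 ^ N <= 2 * G)%N -> (51 / 32) ^+ N * expR D <= G%:R / 8.
Proof.
move=> N16 DN NG.
have e64 : expR (64^-1 : R) <= 64 / 63.
  have := expR_ge1Dx (- 64^-1 : R); rewrite expRN => h.
  rewrite -[leLHS]invrK -[leRHS]invrK lef_pV2 ?posrE ?invr_gt0 ?expR_gt0//; lra.
have eD : expR D <= (64 / 63) ^+ N.
  apply: (@le_trans _ _ (expR (64^-1) ^+ N)).
    by rewrite -expRM_natl ler_expR.
  by apply: lerXn2r => //; rewrite nnegrE ?expR_ge0//; lra.
have NG' : 2 ^+ N <= 2 * G%:R :> R by rewrite -natrX -natrM ler_nat.
have h16 : (17 / 21) ^+ N <= 16^-1 :> R.
  apply: (@le_trans _ _ ((17 / 21) ^+ 16)); last by lra.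
  by rewrite ler_wiXn2l//; lra.
apply: (@le_trans _ _ ((51 / 32) ^+ N * (64 / 63) ^+ N)).
  by rewrite ler_wpM2l// exprn_ge0//; lra.
rewrite -exprMn (_ : 51 / 32 * (64 / 63) = 2 * (17 / 21)); last by field.
rewrite exprMn; apply: (@le_trans _ _ (2 ^+ N * 16^-1)).
  by rewrite ler_wpM2l// exprn_ge0.
lra.
Qed.

Lemma close_row_sqr m (x y w : 'I_m -> R) b :
  \sum_j (x j - w j) ^+ 2 < b -> \sum_j (y j - w j) ^+ 2 < b ->
  \sum_j (x j - y j) ^+ 2 <= 4 * b.
Proof.
move=> hx hy.
apply: (@le_trans _ _ (\sum_j (2 * (x j - w j) ^+ 2 + 2 * (y j - w j) ^+ 2))).
  (* Parallelogram law: the difference of the two sides is this square. *)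
  by apply: ler_sum => j _; have := sqr_ge0 (x j + y j - 2 * w j); lra.
by rewrite big_split /= -!mulr_sumr; lra.
Qed.

(** Rotating the frames instead of W makes both of them close to the same W, hence to each other,
    and a rotated frame is again a frame for the same V. *)
Lemma frame_d2inf_close K q z r (V V' : 'M[R]_(q, r)) T T' W rho : (0 < K)%N ->
  whitens V T -> whitens V' T' ->
  d2inf W (frame K z V T) < rho -> d2inf W (frame K z V' T') < rho ->
  sqfrob (V - V') <= 3 * (sqfrob (V^T *m V) + sqfrob (V'^T *m V') +
    2 * ((K * r + q)%:R * (4 * rho ^+ 2))).
Proof.
move=> K0 wT wT' /d2inf_lt[G oG hG] /d2inf_lt[G' oG' hG'].
have trO (H : 'M[R]_r) : orthogonal_mx H -> orthogonal_mx H^T.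
  by move=> /mulmx1C; rewrite /orthogonal_mx trmxK.
have rot (X : 'M[R]_(K * r + q + z, r)) H : orthogonal_mx H ->
    norm2inf (X *m H^T - W) = norm2inf (X - W *m H).
  move=> oH; rewrite -[RHS](norm2inf_mulmx_orthogonal _ (trO _ oH)).
  by rewrite mulmxBl -[W *m H *m _]mulmxA (mulmx1C oH) mulmx1.
move: hG hG'; rewrite -!rot// !frame_mulmx => hG hG'.
apply: (frame_separation K0 (whitens_orthogonal wT (trO _ oG))
  (whitens_orthogonal wT' (trO _ oG'))) => i.
have hi := row_lt_norm2inf i hG; have hi' := row_lt_norm2inf i hG'.
under eq_bigr do rewrite !mxE.
by apply: (@close_row_sqr _ _ _ (W i)); [move: hi|move: hi'];
  under eq_bigr do rewrite !mxE.
Qed.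

(** The dimension is written as a sum to match the blocks of [frame]; b is the bound on squared row
    norms. *)
Lemma packing_lower_bound K q z r (b sigma lam : R)
    (Uhat : 'M[R]_(K * r + q + z) -> 'M[R]_(K * r + q + z, r)) :
  (0 < K)%N -> (0 < r)%N -> (r <= q)%N -> (16 <= q)%N -> (K * r <= 2 * q)%N ->
  K%:R^-1 <= b -> r%:R / (120 * q%:R) <= b -> 0 < sigma ->
  lam ^+ 2 / sigma ^+ 2 <= q%:R / 64 ->
  measurable_estimator Uhat ->
  exists U, [/\ U^T *m U = 1%:M, forall i, \sum_j U i j ^+ 2 <= b &
    ((Num.sqrt (r%:R / (12 * 120 ^+ 2 * q%:R)) / 2)%:E <= risk sigma lam Uhat U)%E].
Proof.
move=> K0 r0 rq q16 Krq Kb qb s0 lamq mU.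
have q0 : 0 < q%:R :> R by rewrite ltr0n; lia.
have Kq : (K * r + q)%:R <= 3 * q%:R :> R by rewrite -natrM ler_nat mulSn addnC leq_add2l.
have rR0 : 0 < r%:R :> R by rewrite ltr0n.
pose a : R := Num.sqrt (120 * q%:R)^-1.
have a2 : a ^+ 2 = (120 * q%:R)^-1 by rewrite sqr_sqrtr// invr_ge0 mulr_ge0// ltW.
pose rho : R := Num.sqrt (r%:R / (12 * 120 ^+ 2 * q%:R)).
have rho2 : rho ^+ 2 = r%:R / (12 * 120 ^+ 2 * q%:R).
  by rewrite sqr_sqrtr// divr_ge0 ?mulr_ge0 ?(ltW rR0) ?(ltW q0).
have rho0 : 0 < rho by rewrite sqrtr_gt0 divr_gt0// mulr_gt0.
pose V (S : {ffun 'I_q * 'I_r -> bool}) : 'M[R]_(q, r) := a *: sgnmx S.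
pose T S := projT1 (cid (whitens_exists (V S))).
have wT S : whitens (V S) (T S) by rewrite /T; case: cid.
pose U S := frame K z (V S) (T S).
have U1 S : (U S)^T *m U S = 1%:M by exact: frame_gram.
have Ub S i : \sum_j U S i j ^+ 2 <= b.
  apply: frame_row_le => // k; apply: le_trans qb.
  under eq_bigr do rewrite mxE exprMn.
  by rewrite -mulr_sumr sgnmx_row a2 mulrC.
pose good := [pred S : {ffun 'I_q * 'I_r -> bool} |
     sqfrob ((sgnmx S)^T *m sgnmx S) <= 4 * r%:R * q%:R ^+ 2 :> R].
have ngood : (2 ^ (q * r) <= 2 * #|good|)%N by exact: card_balanced_signs.
have Vgood S : good S -> sqfrob ((V S)^T *m V S) <= r%:R / (30 * 120).
  rewrite /= /V [(_ *: sgnmx S)^T]linearZ /= -scalemxAl -scalemxAr scalerA sqfrobZ -expr2 a2 => h.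
  apply: (@le_trans _ _ ((120 * q%:R)^-1 ^+ 2 * (4 * r%:R * q%:R ^+ 2))).
    by rewrite ler_wpM2l// sqr_ge0.
  by rewrite le_eqVlt; apply/orP; left; apply/eqP; field; rewrite gt_eqF.
have [] := @chi2_fano R sigma (size (upper_pairs (K * r + q + z))) _
  (enum good) (fun S => upper_seq (U S *m (lam%:M : 'M[R]_r) *m (U S)^T))
  (fun S l => d2inf (Uhat (sym_of_seq _ l)) (U S)) rho ((51 / 32) ^+ (q * r))
  (lam ^+ 2 * r%:R / sigma ^+ 2).
- by rewrite gt_eqF.
- exact: rho0.
- by rewrite -cardE lt0n; apply/eqP => g0; move: ngood; rewrite g0 muln0 leqn0 expn_eq0.
- by move=> S; rewrite size_map.
- move=> S; rewrite -mulr_suml ler_wpM2r ?invr_ge0 ?sqr_ge0//.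
  by apply: le_trans (sum_upper_seq _) _; rewrite sqfrob_gram.
- by move=> S l; exact: d2inf_ge0.
- by move=> S; apply: measurable_d2inf.
(* Fix one compatible S0, if any: all the others lie in a Hamming ball around it. *)
- move=> l; set P := (fun S => _).
  have [/hasP[S0]|/hasPn h] := boolP (has P (enum good)); last first.
    rewrite (_ : count _ _ = 0%N); first by rewrite exprn_ge0.
    by apply/eqP; rewrite -leqn0 leqNgt -has_count; apply/hasPn.
  rewrite mem_enum => gS0 PS0.
  have := card_hamming_ball (R := R) S0; rewrite card_prod !card_ord.
  apply: le_trans; rewrite ler_nat -size_filter -(card_uniqP _); last first.
    by rewrite filter_uniq// enum_uniq.
  apply: subset_leq_card; apply/fintype.subsetP => S.
  rewrite mem_filter mem_enum => /andP[PS gS]; rewrite inE.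
  have := frame_d2inf_close K0 (wT S0) (wT S) PS0 PS.
  rewrite /V -scalerBr sqfrobZ sqfrob_sgnmxB a2 rho2.
  have := Vgood _ gS; have := Vgood _ gS0; rewrite /V.
  set x := sqfrob _; set y := sqfrob _ => hx hy hS.
  have hE : (K * r + q)%:R * (4 * (r%:R / (12 * 120 ^+ 2 * q%:R))) <= r%:R / 120 ^+ 2 :> R.
    apply: (@le_trans _ _ (3 * q%:R * (4 * (r%:R / (12 * 120 ^+ 2 * q%:R))))).
      by rewrite ler_wpM2r// mulr_ge0// divr_ge0 ?mulr_ge0 ?(ltW rR0) ?(ltW q0).
    by rewrite le_eqVlt; apply/orP; left; apply/eqP; field; rewrite gt_eqF.
  (* The constants 120 and 12 are tuned for this: 3 (2 r / 3600 + 2 r / 120^2) = r / 480, which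
     amounts to a Hamming distance of at most q r / 16. *)
  have : (120 * q%:R)^-1 * (4 * (hamming S0 S)%:R) <= r%:R / (4 * 120) :> R by lra.
  rewrite ler_pdivrMl ?mulr_gt0// => h.
  rewrite -(ler_nat R) !natrM; lra.
- rewrite -cardE; apply: fano_exponent.
  + by rewrite (leq_trans q16)// leq_pmulr.
  + by rewrite mulrAC natrM [q%:R * _ / _]mulrAC ler_wpM2r// ltW.
  + exact: ngood.
move=> S _ hS; exists (U S); split; [exact: U1|exact: Ub|].
apply: le_trans hS _; rewrite le_eqVlt; apply/orP; left; apply/eqP.
apply: eq_gauss_iter => l sl; rewrite upper_seqD//.
by rewrite !trmx_mul trmxK tr_scalar_mx mulmxA.
Qed.

End packing.

(** * Numerical estimates and the choice of parameters *)

Lemma truncn_succP (R : realType) (x : R) : 0 <= x ->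
  x <= (Num.truncn x).+1%:R <= x + 1.
Proof.
move=> /Num.Theory.truncn_itv /andP[h1 h2]; rewrite (ltW h2) /= -natr1; lra.
Qed.

Lemma expR2_le16 (R : realType) : expR 2 <= 16 :> R.
Proof.
have h : expR (2^-1 : R) <= 2.
  have := expR_ge1Dx (- 2^-1 : R); rewrite expRN => h.
  rewrite -[leLHS]invrK -[leRHS]invrK lef_pV2 ?posrE ?invr_gt0 ?expR_gt0//; lra.
rewrite (_ : 2 = 4%:R * 2^-1); last by field.
rewrite expRM_natl (_ : 16 = 2 ^+ 4); last by rewrite -natrX.
by apply: lerXn2r => //; rewrite nnegrE// expR_ge0.
Qed.

Lemma ln_ge1 (R : realType) (x : R) : 4 <= x -> 1 <= ln x.
Proof.
move=> x4; have x0 : 0 < x by lra.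
rewrite -ler_expR lnK ?posrE//; apply: le_trans x4.
have := @expR2_le16 R; rewrite (_ : 2 = 1 + 1)// expRD -expr2.
by rewrite (_ : 16 = 4 ^+ 2) ?ler_pXn2r ?nnegrE ?expR_ge0// -natrX.
Qed.

Lemma ln_ge2 (R : realType) (x : R) : 16 <= x -> 2 <= ln x.
Proof.
move=> x4; have x0 : 0 < x by lra.
by rewrite -ler_expR lnK ?posrE//; exact: le_trans (@expR2_le16 R) x4.
Qed.

(** The minimum is that of sqrt (r / t) and sqrt (r / (s L)), with L >= 1. Whichever argument of the
    maximum dominates selects the term to compare with sqrt (r / q). The losses 10, 500 and 2
    multiply to 10^4. *)
Lemma rate_le (R : realType) (q r n mu sigma lam : R) :
  0 < r -> 0 < n -> 0 < mu -> 4 <= n / mu -> 0 < sigma -> 0 < lam -> 0 < q ->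
  q <= Num.max (4 * (n / mu)) (64 * (lam ^+ 2 / sigma ^+ 2)) + 1 ->
  Num.min (sigma * Num.sqrt r / lam) (Num.sqrt (mu * r / (n * ln (n / mu)))) / 10 ^+ 4 <=
  Num.sqrt (r / (12 * 120 ^+ 2 * q)) / 2.
Proof.
move=> r0 n0 m0 s4 sg0 l0 q0 hq.
set s := n / mu in s4 hq *; set t := lam ^+ 2 / sigma ^+ 2 in hq.
have t0 : 0 < t by rewrite divr_gt0 ?exprn_gt0.
have ls := ln_ge1 s4; set L := ln s in ls *.
have -> : sigma * Num.sqrt r / lam = Num.sqrt (r / t).
  rewrite [RHS]sqrtrM ?(ltW r0)// sqrtrV ?(ltW t0)// /t sqrtrM ?sqr_ge0//.
  rewrite sqrtrV ?sqr_ge0// !sqrtr_sqr !gtr0_norm//; field.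
  by rewrite !gt_eqF.
have -> : mu * r / (n * L) = r / (s * L).
  by rewrite /s; field; rewrite !gt_eqF// (lt_le_trans _ ls).
have sqrt_leM x y c : 0 <= c -> x <= c ^+ 2 * y -> Num.sqrt x <= c * Num.sqrt y.
  move=> c0 xy; rewrite -[in leRHS](ger0_norm c0) -sqrtr_sqr -sqrtrM ?sqr_ge0//.
  exact: ler_wsqrtr.
have rq0 : 0 < r / q by rewrite divr_gt0.
have qX x : 0 < x -> q <= 100 * x -> Num.sqrt (r / x) <= 10 * Num.sqrt (r / q).
  move=> x0 qx; apply: sqrt_leM => //.
  rewrite ler_pdivrMr// (_ : _ * x = r * (100 * x / q)); last by field; rewrite gt_eqF.
  by rewrite ler_peMr ?(ltW r0)// ler_pdivlMr// mul1r.
have key : Num.min (Num.sqrt (r / t)) (Num.sqrt (r / (s * L))) <= 10 * Num.sqrt (r / q).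
  rewrite ge_min; apply/orP; have [h|h] := leP (64 * t) (4 * s).
    right; apply: qX; first by rewrite mulr_gt0//; lra.
    have : s * 1 <= s * L by rewrite ler_wpM2l//; lra.
    move: hq; rewrite (max_idPl h); lra.
  by left; apply: qX => //; move: hq; rewrite (max_idPr (ltW h)); lra.
have : Num.sqrt (r / q) <= 500 * Num.sqrt (r / (12 * 120 ^+ 2 * q)).
  apply: sqrt_leM => //.
  rewrite (_ : 500 ^+ 2 * _ = (500 ^+ 2 / (12 * 120 ^+ 2)) * (r / q)); last first.
    by field; rewrite gt_eqF.
  by rewrite ler_peMl ?(ltW rq0)//; lra.
move: key; rewrite -[10 ^+ 4]/(10 ^+ (1 + 3)) exprD; set m := Num.min _ _.
set y := Num.sqrt (r / q); set w := Num.sqrt (r / _); lra.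
Qed.

Theorem theorem2 (R : realType) :
  exists (C0 c : R) (N0 : nat), 0 < C0 /\ 0 < c /\
  forall (n r : nat) (mu sigma lam : R),
    (N0 <= n)%N -> (0 < r)%N -> 0 < mu ->
    Num.max 4 r%:R <= n%:R / mu ->
    12 * ln (12 * n%:R) <= mu ->
    0 < sigma -> 0 < lam ->
    lam <= (6 * Num.sqrt C0)^-1 * sigma * Num.sqrt n%:R ->
    ((c * Num.min (sigma * Num.sqrt r%:R / lam)
                  (Num.sqrt (mu * r%:R / (n%:R * ln (n%:R / mu)))))%:E
     <= ereal_inf [set ereal_sup [set risk sigma lam Uhat U | U in Kset n r mu]
                  | Uhat in [set Uhat : 'M[R]_n -> 'M[R]_(n, r)
                             | measurable_estimator Uhat]])%E.
Proof.
(* C0 = 4 turns the signal bound into t <= n / 144. The threshold is 0 because the hypotheses on mu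
   already force n to be large. *)
exists 4, (10 ^+ 4)^-1, 0%N; split => //; split; first by rewrite invr_gt0 exprn_gt0.
move=> n r mu sigma lam _ r0 mu0; rewrite ge_max => /andP[s4 sr] mun s0 l0 lamn.
have n0 : (0 < n)%N.
  by rewrite lt0n; apply/eqP => n0; move: s4; rewrite n0 mul0r; lra.
have nR0 : 0 < n%:R :> R by rewrite ltr0n.
have n1 : 1 <= n%:R :> R by rewrite ler1n.
have rR0 : 0 < r%:R :> R by rewrite ltr0n.
set s := n%:R / mu in s4 sr.
set t := lam ^+ 2 / sigma ^+ 2.
have t0 : 0 < t by rewrite divr_gt0 ?exprn_gt0.
have tn : t <= n%:R / 144.
  rewrite ler_pdivrMr ?exprn_gt0//.
  have : lam ^+ 2 <= ((6 * Num.sqrt 4)^-1 * sigma * Num.sqrt n%:R) ^+ 2.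
    by apply: lerXn2r => //; rewrite nnegrE ?(ltW l0) ?(le_trans (ltW l0) lamn).
  rewrite !exprMn exprVn exprMn !sqr_sqrtr//; lra.
(* Bootstrap: mu >= 12 gives n >= 48, then ln (12 n) >= 2 gives mu >= 24. *)
have sn : 14 * s <= n%:R.
  have musn : mu * s = n%:R by rewrite /s mulrC divfK ?gt_eqF.
  have mu12 : 12 <= mu by have := @ln_ge1 R (12 * n%:R); lra.
  have : mu * 4 <= mu * s by rewrite ler_wpM2l// ltW.
  rewrite musn => n48; have mu24 : 24 <= mu by have := @ln_ge2 R (12 * n%:R); lra.
  by rewrite -musn ler_wpM2r//; lra.
(* K >= s / r makes the rows of [spread] incoherent. For q, the term 4 s ensures q >= 16 and q >= r,
   and 64 t controls the chi-square divergence. *)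
pose K := (Num.truncn (s / r%:R)).+1.
pose q := (Num.truncn (Num.max (4 * s) (64 * t))).+1.
have /andP[K1 K2] := @truncn_succP R (s / r%:R) ltac:(by rewrite divr_ge0 ?(ltW rR0)//; lra).
have /andP[q1 q2] := @truncn_succP R (Num.max (4 * s) (64 * t)) ltac:(by rewrite le_max (_ : 0 <= 4 * s)//; lra).
rewrite -/K in K1 K2; rewrite -/q in q1 q2.
move: (q1); rewrite ge_max => /andP[qs qt].
have Kr : (K * r)%:R <= 2 * s.
  rewrite natrM; apply: (@le_trans _ _ ((s / r%:R + 1) * r%:R)); first by rewrite ler_wpM2r// ltW.
  by rewrite mulrDl mul1r divfK ?gt_eqF//; lra.
(* The blocks fit: 2 s + 4 s + 64 t + 1 <= 6 n / 14 + 4 n / 9 + 1 <= n, as n >= 14 s >= 56. *)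
have Kqn : (K * r + q <= n)%N.
  rewrite -(ler_nat R) natrD; have : Num.max (4 * s) (64 * t) <= 4 * s + 64 * t.
    by rewrite ge_max; apply/andP; split; lra.
  lra.
have Krq : (K * r <= 2 * q)%N by rewrite -(ler_nat R) natrM; lra.
have rq : (r <= q)%N by rewrite -(ler_nat R); lra.
have q16 : (16 <= q)%N by rewrite -(ler_nat R); lra.
have rate : Num.min (sigma * Num.sqrt r%:R / lam)
    (Num.sqrt (mu * r%:R / (n%:R * ln (n%:R / mu)))) / 10 ^+ 4 <=
    Num.sqrt (r%:R / (12 * 120 ^+ 2 * q%:R)) / 2.
  by apply: rate_le; rewrite // ?ltr0n.
have K0 : (0 < K)%N by [].
have Kb : K%:R^-1 <= r%:R / s.
  by rewrite -[leRHS]invf_div lef_pV2 ?posrE ?ltr0n// divr_gt0//; lra.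
have qR0 : 0 < q%:R :> R by lra.
have qb : r%:R / (120 * q%:R) <= r%:R / s.
  by rewrite ler_wpM2l ?(ltW rR0)// lef_pV2 ?posrE//; lra.
have tq : t <= q%:R / 64 by rewrite ler_pdivlMr//; lra.
have sE : r%:R / s = r%:R * mu / n%:R by rewrite /s invf_div mulrA.
have [z nE] : exists z, n = (K * r + q + z)%N by exists (n - (K * r + q))%N; rewrite subnKC.
rewrite sE in Kb qb; rewrite /t in tq.
apply: le_ereal_inf_tmp => _ [Uhat mU <-].
clearbody K q; clear -nE K0 r0 rq q16 Krq Kb qb s0 tq mU rate mu0 nR0 rR0; subst n.
have [U [U1 Ub hU]] := packing_lower_bound K0 r0 rq q16 Krq Kb qb s0 tq mU.
apply: (@le_trans _ _ (risk sigma lam Uhat U)).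
  by apply: le_trans hU; rewrite lee_fin mulrC.
apply: ereal_sup_ubound; exists U => //; split => //.
apply: norm2inf_le; first exact: sqrtr_ge0.
move=> i; rewrite sqr_sqrtr; first exact: Ub.
by rewrite divr_ge0 ?mulr_ge0 ?(ltW rR0) ?(ltW mu0) ?(ltW nR0).
Qed.
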